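(* Let $(X,d)$ be a complete metric space with $X$ nonempty, let $T:X\to X$ be a map, and suppose that $T$ is $(a,F)$-contractive for some real $a>0$ and some Wardowski function $F:[0,\infty[\,\to\mathbb{R}\cup\{-\infty\}$, i.e. $$a+F(d(Tx,Ty))\le F(d(x,y))\quad\text{for all } x,y\in X \text{ with } x\ne y.$$ Then: (j) If, in addition, $F$ is left-continuous, then $T$ is a globally strong Picard operator (modulo $d$). (jj) If, moreover, $F$ is left-continuous and regular, then $T$ is a globally strong tele-Picard operator (modulo $d$).
   Context: A function $F:[0,\infty[\,\to\mathbb{R}\cup\{-\infty\}$ is a Wardowski function if: (1) $F(t)=-\infty$ if and only if $t=0$; (2) $F$ is strictly increasing: $t<s$ implies $F(t)<F(s)$; (3) $F(t)\to-\infty$ as $t\to 0+$. The usual conventions for $-\infty$ apply ($-\infty<r$ and $r+(-\infty)=-\infty$ for every real $r$; $-\infty\le-\infty$). $F$ is left-continuous if $\lim_{s\to t-}F(s)=F(t)$ for all $t>0$. $F$ is $k$-regular (for $k>0$) if $t^kF(t)\to 0$ as $t\to 0+$; $F$ is regular if it is $k$-regular for some $k\in\,]0,1[$. A sequence $(x_n;n\ge 0)$ in $X$ is $d$-Cauchy if it is Cauchy in the metric $d$, $d$-convergent if it converges in the metric $d$ to a point of $X$, and $d$-tele-Cauchy if $\sum_{n\ge 0} d(x_n,x_{n+1})<\infty$. Let $\mathrm{Fix}(T)=\{z\in X: Tz=z\}$. $T$ is a Picard (resp. tele-Picard) operator (modulo $d$) if, for each $x\in X$, the sequence $(T^nx;n\ge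 0)$ is $d$-Cauchy (resp. $d$-tele-Cauchy) and $d$-convergent. It is a strong Picard (resp. strong tele-Picard) operator if it is a Picard (resp. tele-Picard) operator and, for each $x\in X$, the limit of $(T^nx;n\ge 0)$ belongs to $\mathrm{Fix}(T)$. It is a globally strong Picard (resp. globally strong tele-Picard) operator if it is a strong Picard (resp. strong tele-Picard) operator and $\mathrm{Fix}(T)$ has at most one element (hence exactly one element). *)

(* Defs.v *)
From HB Require Import structures.
From mathcomp Require Import all_boot all_order all_algebra.
From mathcomp Require Import all_classical all_reals all_analysis.

Set Implicit Arguments.
Unset Strict Implicit.
Unset Printing Implicit Defensive.

Import Order.TTheory GRing.Theory Num.Theory.
Import numFieldNormedType.Exports.

Local Open Scope classical_set_scope.
Local Open Scope ring_scope.

(* A [completeType] is pointed, so this is the type of nonempty complete metric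
   spaces. *)
#[short(type="completeMetricType")]
HB.structure Definition CompleteMetric (R : numDomainType) :=
  {X of Complete X & Metric R X}.

(* [F] stands for a function on [0, +oo[ with values in the real line extended
   by -oo: the predicates below only constrain [F] on nonnegative arguments,
   where the value +oo is excluded. *)
Definition wardowski {R : realType} (F : R -> \bar R) : Prop :=
  [/\ forall t, 0 <= t -> F t <> +oo%E,
      forall t, 0 <= t -> (F t = -oo%E <-> t = 0),
      forall t s, 0 <= t -> t < s -> (F t < F s)%E
    & F t @[t --> 0^'+] --> -oo%E].

Definition left_cont {R : realType} (F : R -> \bar R) : Prop :=
  forall t, 0 < t -> F s @[s --> t^'-] --> F t.

Definition k_regular {R : realType} (k : R) (F : R -> \bar R) : Prop :=
  ((t `^ k)%:E * F t)%E @[t --> 0^'+] --> 0%E.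

Definition regular_fun {R : realType} (F : R -> \bar R) : Prop :=
  exists k, [/\ 0 < k, k < 1 & k_regular k F].

Definition contractive {R : realType} {X : metricType R} (a : R)
    (F : R -> \bar R) (T : X -> X) : Prop :=
  forall x y, x <> y ->
    (a%:E + F (mdist (T x) (T y)) <= F (mdist x y))%E.

Definition Fix {X : Type} (T : X -> X) : set X := [set z | T z = z].

Definition orbit_seq {X : Type} (T : X -> X) (x : X) : nat -> X :=
  fun n => iter n T x.

Definition cauchy_seq {R : realType} {X : metricType R} (u : nat -> X) : Prop :=
  cauchy (u @ \oo).

Definition convergent_seq {R : realType} {X : metricType R} (u : nat -> X) :
    Prop :=
  exists z : X, u @ \oo --> z.

Definition tele_cauchy_seq {R : realType} {X : metricType R} (u : nat -> X) :
    Prop :=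
  (\sum_(0 <= n <oo) (mdist (u n) (u n.+1))%:E < +oo)%E.

Definition picard {R : realType} {X : metricType R} (T : X -> X) : Prop :=
  forall x, cauchy_seq (orbit_seq T x) /\ convergent_seq (orbit_seq T x).

Definition tele_picard {R : realType} {X : metricType R} (T : X -> X) : Prop :=
  forall x, tele_cauchy_seq (orbit_seq T x) /\ convergent_seq (orbit_seq T x).

Definition limits_in_Fix {R : realType} {X : metricType R} (T : X -> X) :
    Prop :=
  forall x z : X, orbit_seq T x @ \oo --> z -> Fix T z.

Definition strong_picard {R : realType} {X : metricType R} (T : X -> X) : Prop :=
  picard T /\ limits_in_Fix T.

Definition strong_tele_picard {R : realType} {X : metricType R} (T : X -> X) :
    Prop :=
  tele_picard T /\ limits_in_Fix T.

Definition globally_strong_picard {R : realType} {X : metricType R}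
    (T : X -> X) : Prop :=
  strong_picard T /\ is_subset1 (Fix T).

Definition globally_strong_tele_picard {R : realType} {X : metricType R}
    (T : X -> X) : Prop :=
  strong_tele_picard T /\ is_subset1 (Fix T).

(* Main.v *)
Require Import Defs.
From mathcomp Require Import all_boot all_order all_algebra.
From mathcomp Require Import all_classical all_reals all_analysis.
From mathcomp Require Import ring lra.

(** Iterating the contraction inequality gives
    n a + F (d (T^n x, T^n y)) <= F (d (x, y)).  As F is increasing and finite
    away from 0, this forces d (T^n x, T^n y) --> 0; in particular the steps
    d_n = d (T^n x, T^n+1 x) tend to 0.  The inequality also makes T strictly
    decrease positive distances, so T is continuous (limits of orbits are
    fixed) and has at most one fixed point.

    Cauchy property ([contractive_cauchy]).  Fix e > 0.  Left continuity of F
    at e provides s < e such that T sends pairs at distance at most e to pairs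
    at distance less than s ([left_cont_gap]).  As soon as d_m < e - s, the
    ball of radius e around x_m = T^m x contains every later term of the orbit,
    by induction: d (x_m, x_n+1) <= d_m + d (x_m+1, x_n+1) < (e - s) + s.
    Completeness then gives convergence.

    Summability ([contractive_tele_cauchy]).  If F is k-regular, then
    d_n ^ k F (d_n) > - a / 2 for large n with d_n > 0, while
    F (d_n) <= F (d_0) - n a <= - n a / 2.  Hence n d_n ^ k <= 1, that is
    d_n <= n ^ (- 1 / k) with 1 / k > 1, and the series of the d_n converges by
    comparison ([summable_le_powR]). *)

Set Implicit Arguments.
Unset Strict Implicit.
Unset Printing Implicit Defensive.

Import Order.TTheory GRing.Theory Num.Theory.
Import numFieldNormedType.Exports.

Local Open Scope classical_set_scope.
Local Open Scope ring_scope.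

(** * Convergence of p-series *)

(** Up to the factor [q], the general term of the series of exponent [q + 1] is
    at most a difference of consecutive values of [x `^ (- q)], a discrete form
    of the integral test.  After division by [y `^ (- q)] with [y = x + 1], it
    is the tangent bound [1 + q / y <= (x / y) `^ (- q)], which comes from
    [ln (x / y) <= - y^-1] and [1 + z <= expR z]. *)
Lemma powR_telescope (R : realType) (q x : R) : 0 <= q -> 0 < x ->
  q * (x + 1) `^ (- (q + 1)) <= x `^ (- q) - (x + 1) `^ (- q).
Proof.
move=> q0 x0; set y := x + 1; set t := x / y.
have y0 : 0 < y by rewrite addr_gt0.
have t0 : 0 < t by rewrite divr_gt0.
have -> : x `^ (- q) = y `^ (- q) * t `^ (- q).
  by rewrite -powRM ?ltW// mulrC divfK ?gt_eqF.
have -> : y `^ (- (q + 1)) = y `^ (- q) * y^-1.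
  by rewrite opprD powRD ?(gt_eqF y0) ?implybT// powR_inv1 ?ltW.
rewrite -[X in _ - X]mulr1 -mulrBr mulrCA ler_wpM2l ?powR_ge0//.
have lnt : ln t <= - y^-1.
  have := le_ln1Dx (x := - y^-1).
  have -> : 1 + - y^-1 = t by rewrite /t /y; field; rewrite gt_eqF.
  by apply; rewrite ltrN2 invf_lt1// ltrDr.
rewrite /powR gt_eqF// lerBrDr addrC; apply: le_trans (expR_ge1Dx _).
by rewrite lerD2l mulNr -mulrN ler_wpM2l// lerNr.
Qed.

(** The hypothesis reads [u n <= n `^ (- k^-1)] eventually; the exponent [k^-1]
    exceeds 1, so that [powR_telescope] with [q = k^-1 - 1] bounds the tail. *)
Lemma summable_le_powR (R : realType) (u : nat -> R) (k : R) :
  0 < k -> k < 1 -> (forall n, 0 <= u n) ->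
  (\forall n \near \oo, n%:R * u n `^ k <= 1) ->
  (\sum_(0 <= n <oo) (u n)%:E < +oo)%E.
Proof.
move=> k0 k1 u0 [N _ uN].
pose q : R := k^-1 - 1.
have q0 : 0 < q by rewrite subr_gt0 invf_gt1.
have step n : (N < n)%N ->
    u n.+1 <= q^-1 * (n%:R `^ (- q) - n.+1%:R `^ (- q)).
  move=> Nn.
  have n0 : (0 : R) < n%:R by rewrite ltr0n (leq_ltn_trans _ Nn).
  rewrite -ler_pdivrMl ?invr_gt0// invrK -natr1.
  apply: le_trans (powR_telescope (ltW q0) n0).
  rewrite ler_wpM2l ?(ltW q0)// natr1 subrK.
  have -> : u n.+1 = (u n.+1 `^ k) `^ k^-1.
    by rewrite -powRrM mulfV ?gt_eqF// powRr1.
  rewrite -mulN1r powRrM.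
  rewrite ge0_ler_powR ?invr_ge0 ?(ltW k0)// ?nnegrE ?powR_ge0//.
  rewrite powR_inv1// -[leRHS]mulr1 ler_pdivlMl ?ltr0n//.
  by apply: uN => /=; rewrite (leq_trans (ltnW Nn)).
have u0E n : (0 <= (u n)%:E)%E by rewrite lee_fin.
(* [step] bounds [u i.+1] for [i > N], whence a tail starting at [N.+2]. *)
rewrite (nneseries_split _ N.+2)//.
rewrite lte_add_pinfty// add0n; first by rewrite sumEFin ltry.
apply: (@le_lt_trans _ _ (q^-1 * N.+1%:R `^ (- q))%:E); last by rewrite ltry.
apply: lime_le; first exact: is_cvg_ereal_nneg_natsum.
exists N.+2 => // n /= Nn; rewrite sumEFin lee_fin.
case: n Nn => // n Nn; rewrite big_add1/=.
apply: (@le_trans _ _ (\sum_(N.+1 <= i < n)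
    q^-1 * (i%:R `^ (- q) - i.+1%:R `^ (- q)))).
  by rewrite ler_sum_nat// => i /andP[Ni _]; exact: step.
rewrite -big_distrr/= ler_wpM2l ?invr_ge0 ?(ltW q0)//.
under eq_bigr do rewrite -opprB.
rewrite sumrN (telescope_sumr (fun i => i%:R `^ (- q)))// opprB.
by rewrite gerBl powR_ge0.
Qed.

(** * Wardowski functions *)

Section Wardowski.
Variables (R : realType) (F : R -> \bar R).
Hypothesis wF : wardowski F.

Lemma wardowski_fin_num t : 0 < t -> F t \is a fin_num.
Proof.
case: wF => Fy FNy _ _ t0.
rewrite fin_numE; apply/andP; split; apply/eqP; last exact/Fy/ltW.
by move/(FNy _ (ltW t0)) => t00; rewrite t00 ltxx in t0.
Qed.

Lemma wardowski0 : F 0 = -oo%E.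
Proof. by case: wF => _ FNy _ _; apply/FNy. Qed.

Lemma wardowski_real_ub t : 0 <= t -> exists c, (F t <= c%:E)%E.
Proof.
case: wF => Fy _ _ _ /Fy; case: (F t) => [c _|//|_]; first by exists c.
by exists 0; rewrite leNye.
Qed.

Lemma wardowski_le t s : 0 <= t -> t <= s -> (F t <= F s)%E.
Proof.
case: wF => _ _ Flt _ t0; rewrite le_eqVlt => /predU1P[->//|ts].
exact/ltW/Flt.
Qed.

Lemma wardowski_lt_inv t s : 0 <= s -> (F t < F s)%E -> t < s.
Proof.
move=> s0; rewrite !ltNge; apply: contra; exact: wardowski_le.
Qed.

(** This is the only use of left continuity: [F] stays above [F e - a] on some
    interval [[s, e]], so a point [t] where [F t <= F e - a] must lie below
    [s].  With [F t] and [F e] the values at the distances of two images and of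
    two points, the contraction shrinks distance [e] by at least [e - s]. *)
Lemma left_cont_gap a e : left_cont F -> 0 < a -> 0 < e ->
  exists s, [/\ 0 < s, s < e &
    forall t, (a%:E + F t <= F e)%E -> t < s].
Proof.
move=> lF a0 e0.
have Fe := wardowski_fin_num e0.
have H : (F e - a%:E < F e)%E by rewrite lteBlDr// lteDl// lte_fin.
have : \forall s \near e^'-, (F e - a%:E < F s)%E.
  exact: (lF e e0 [set y | (F e - a%:E < y)%E] (open_ereal_gt' H)).
move=> near_s; near e^'- => s.
have s0 : 0 < s by near: s; exact: nbhs_left_gt.
have se : s < e by near: s; exact: nbhs_left_lt.
have Fs : (F e - a%:E < F s)%E by near: s.
exists s; split => //.
move=> t; rewrite addeC -leeBrDr// => Ft.
exact: (wardowski_lt_inv (ltW s0) (le_lt_trans Ft Fs)).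
Unshelve. all: by end_near. Qed.

End Wardowski.

(** * Orbits of a contractive map *)

Section Contraction.
Variables (R : realType) (X : metricType R) (T : X -> X) (a : R).
Variable F : R -> \bar R.
Hypotheses (a0 : 0 < a) (wF : wardowski F) (cT : contractive a F T).

(** The convention [a + -oo = -oo] makes the inequality true on the diagonal
    too, so that the arguments below never need to separate the case of an
    orbit that becomes stationary. *)
Lemma contractive_le x y :
  (a%:E + F (mdist (T x) (T y)) <= F (mdist x y))%E.
Proof.
have [->|/eqP xy] := eqVneq x y; last exact: cT.
by rewrite !mdistxx (wardowski0 wF).
Qed.

Lemma contractive_lt x y : x <> y -> mdist (T x) (T y) < mdist x y.
Proof.
move=> xy; apply: (wardowski_lt_inv wF (mdist_ge0 _ _)).
have d0 : 0 < mdist x y by rewrite mdist_gt0; apply/eqP.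
have := cT xy; rewrite addeC -leeBrDr// => /le_lt_trans; apply.
by rewrite lteBlDr// lteDl ?lte_fin// wardowski_fin_num.
Qed.

Lemma contractive_nonexpansive x y : mdist (T x) (T y) <= mdist x y.
Proof.
have [->|/eqP xy] := eqVneq x y; first by rewrite !mdistxx.
exact/ltW/contractive_lt.
Qed.

Lemma contractive_iter n x y :
  ((n%:R * a)%:E + F (mdist (iter n T x) (iter n T y)) <= F (mdist x y))%E.
Proof.
elim: n => [|n IH]; first by rewrite mul0r add0e.
apply: le_trans IH; rewrite -natr1 mulrDl mul1r EFinD -addeA.
by rewrite leeD2l// contractive_le.
Qed.

(** If the distance stayed at least [e], then [n a + F e] would be bounded
    above by the fixed value [F (mdist x y)], although [F e] is finite. *)
Lemma contractive_iter_cvg0 x y :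
  mdist (iter n T x) (iter n T y) @[n --> \oo] --> 0.
Proof.
apply/cvgr0Pnorm_lt => e e0.
have Fe := wardowski_fin_num wF e0.
have [c Fc] := wardowski_real_ub wF (mdist_ge0 x y).
near=> n; rewrite ger0_norm ?mdist_ge0//.
apply: (wardowski_lt_inv wF (ltW e0)).
have := le_trans (contractive_iter n x y) Fc.
rewrite addeC -leeBrDr// => /le_lt_trans; apply.
rewrite -(fineK Fe) lte_fin ltrBlDr -ltrBlDl -ltr_pdivrMr//.
near: n; exact: nbhs_infty_gtr.
Unshelve. all: by end_near. Qed.

(** [T], being nonexpansive, is continuous: [T z] is the limit of the shifted
    orbit, hence equal to [z]. *)
Lemma contractive_limits_in_Fix : limits_in_Fix T.
Proof.
move=> x z xz; apply/esym/(@mdist_positivity R).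
apply/eqP; rewrite eq_le mdist_ge0 andbT; apply/ler_addgt0Pr => e e0.
have e2 : 0 < e / 2 by rewrite divr_gt0.
have [n _ xn] := metricType_numDomainType.cvgr_dist_lt xz e2.
have zn := xn n (leqnn n); have zSn := xn n.+1 (leqnSn n).
rewrite add0r (splitr e) (le_trans (metric_triangle _ (orbit_seq T x n.+1) _))//.
rewrite lerD ?(ltW zSn)// metric_sym.
exact: le_trans (contractive_nonexpansive _ _) (ltW zn).
Qed.

Lemma contractive_Fix_subset1 : is_subset1 (Fix T).
Proof.
move=> x y /= Tx Ty; apply: contrapT => /contractive_lt.
by rewrite Tx Ty ltxx.
Qed.

Lemma orbit_step_cvg0 x :
  mdist (orbit_seq T x n) (orbit_seq T x n.+1) @[n --> \oo] --> 0.
Proof.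
under eq_fun do rewrite /orbit_seq iterSr; exact: contractive_iter_cvg0.
Qed.

(** Once a step [x_m, x_m.+1] is shorter than the gap [e - s], the ball of
    radius [e] around [x_m] absorbs the rest of the orbit: the image of a term
    of that ball is within [s] of [x_m.+1], hence within [e] of [x_m]. *)
Lemma contractive_cauchy x : left_cont F -> cauchy_seq (orbit_seq T x).
Proof.
move=> lF; apply/cauchy_exP => e e0.
have [s [s0 se gap]] := left_cont_gap wF lF a0 e0.
have es0 : 0 < e - s by rewrite subr_gt0.
near \oo => m.
have dm : mdist (orbit_seq T x m) (orbit_seq T x m.+1) < e - s.
  near: m; have /cvgr0Pnorm_lt/(_ _ es0) := @orbit_step_cvg0 x.
  by apply: filterS => n; rewrite ger0_norm ?mdist_ge0.
exists (orbit_seq T x m); exists m => // n /= mn; rewrite ballEmdist /=.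
rewrite -(subnK mn); elim: (n - m)%N => [|i IH]; first by rewrite mdistxx.
rewrite addSn (le_lt_trans (metric_triangle _ (orbit_seq T x m.+1) _))//.
rewrite -(subrK s e) ltrD// gap//.
apply: le_trans (contractive_le _ _) _.
exact: (wardowski_le wF (mdist_ge0 _ _) (ltW IH)).
Unshelve. all: by end_near. Qed.

(** The linear decay [F (d n) <= c - n a] and the bound
    [d n `^ k * F (d n) > - (a / 2)] given by regularity combine into
    [n * d n `^ k <= 1] once [c <= n a / 2]. *)
Lemma contractive_tele_cauchy x : regular_fun F -> tele_cauchy_seq (orbit_seq T x).
Proof.
case=> k [k0 k1 kF].
set d := fun n => mdist (orbit_seq T x n) (orbit_seq T x n.+1).
have d_ge0 n : 0 <= d n by exact: mdist_ge0.
apply: (summable_le_powR k0 k1 d_ge0).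
have a2 : 0 < a / 2 by rewrite divr_gt0.
have /(_ [set y | (- (a / 2))%:E < y]%E) := kF.
have /open_ereal_gt' H : ((- (a / 2))%:E < 0)%E by rewrite lte_fin oppr_lt0.
move=> /(_ H)/=[r /= r0 Hr].
have [c Fc] := wardowski_real_ub wF (mdist_ge0 x (T x)).
near=> n.
(* Regularity is a limit at 0 from the right: it says nothing at 0 itself. *)
have [->|dn0] := eqVneq (d n) 0.
  by rewrite powR0 ?gt_eqF// mulr0.
have dn : 0 < d n by rewrite lt_neqAle eq_sym dn0 d_ge0.
have dnr : d n < r.
  near: n; have /cvgr0Pnorm_lt/(_ _ r0) := @orbit_step_cvg0 x.
  by apply: filterS => n; rewrite ger0_norm ?mdist_ge0.
have /= := Hr (d n).
rewrite sub0r normrN gtr0_norm// => /(_ dnr dn).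
have cn : c <= n%:R * (a / 2).
  by rewrite -ler_pdivrMr//; near: n; exact: nbhs_infty_ger.
have := le_trans (contractive_iter n x (T x)) Fc.
rewrite -iterSr -/(d n) -(fineK (wardowski_fin_num wF dn)).
rewrite -EFinM -EFinD lee_fin lte_fin; set f := fine _ => fle kf.
have := powR_gt0 k dn; set p := d n `^ k in kf * => p0.
have : (- (a / 2)) < p * (- (n%:R * (a / 2))).
  by apply: lt_le_trans kf _; rewrite ler_pM2l//; lra.
by rewrite -(ler_pM2r a2) mul1r; lra.
Unshelve. all: by end_near. Qed.

End Contraction.

Theorem theorem2 (R : realType) (X : completeMetricType R) (T : X -> X)
    (a : R) (F : R -> \bar R)
    (a_gt0 : 0 < a) (wardowskiF : wardowski F)
    (contractiveT : contractive a F T) :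
  (left_cont F -> globally_strong_picard T) /\
  (left_cont F -> regular_fun F -> globally_strong_tele_picard T).
Proof.
have lim := contractive_limits_in_Fix a_gt0 wardowskiF contractiveT.
have uniq := contractive_Fix_subset1 a_gt0 wardowskiF contractiveT.
have cvgT x : left_cont F -> convergent_seq (orbit_seq T x).
  move=> lF; apply/cvg_ex/cauchy_cvgP.
  exact: (contractive_cauchy a_gt0 wardowskiF contractiveT).
split=> [lF|lF rF]; split=> //; split=> // x; split; try exact: cvgT.
- exact: (contractive_cauchy a_gt0 wardowskiF contractiveT).
- exact: (contractive_tele_cauchy a_gt0 wardowskiF contractiveT).
Qed.
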